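(* Let $\mu_1,\mu_2$ be two measures on $\mathbb{R}$ of compact support. Suppose that for some interval $(\alpha,\beta)$, (i) $d\mu_1\le d\mu_2$; (ii) $d\mu_1\restriction(\alpha,\beta)=d\mu_2\restriction(\alpha,\beta)$. For $k=1,2$ let $\nu_n^{(k)}$ be the zero counting measure for $\mu_k$. Let $n(j)\to\infty$ and suppose $\nu_{n(j)}^{(k)}\to\nu_\infty^{(k)}$ weakly as $j\to\infty$ for $k=1,2$. Then $$d\nu_\infty^{(2)}\restriction(\alpha,\beta)\le d\nu_\infty^{(1)}\restriction(\alpha,\beta).$$
   Context: Measures are positive, finite, not necessarily normalized, and have infinite support. The zero counting measure $\nu_n^{(k)}$ is the probability measure giving mass $1/n$ to each of the $n$ (simple, real) zeros of the degree-$n$ orthogonal polynomial for $\mu_k$. Inequalities between measures are setwise (on Borel sets), and $\restriction$ denotes restriction. Weak convergence means convergence of integrals of bounded continuous functions. *)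

(* Defs.v *)
From HB Require Import structures.
From mathcomp Require Import all_boot all_order all_algebra.
From mathcomp Require Import polyrcf.
From mathcomp Require Import all_classical all_reals all_analysis.
Set Implicit Arguments.
Unset Strict Implicit.
Unset Printing Implicit Defensive.
Import Order.TTheory GRing.Theory Num.Theory numFieldNormedType.Exports.
Local Open Scope classical_set_scope.
Local Open Scope ring_scope.

Definition measure_support (R : realType)
    (mu : {measure set (measurableTypeR R) -> \bar R}) : set R :=
  [set x | forall U : set R, open U -> U x -> (0 < mu U)%E].

(* Measures are total functions on sets, so comparisons between them are only
   meaningful on measurable (here: Borel) sets. *)
Definition measure_le (R : realType)
    (mu nu : {measure set (measurableTypeR R) -> \bar R}) : Prop :=
  forall A : set (measurableTypeR R), measurable A -> (mu A <= nu A)%E.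

Definition measure_eq (R : realType)
    (mu nu : {measure set (measurableTypeR R) -> \bar R}) : Prop :=
  forall A : set (measurableTypeR R), measurable A -> mu A = nu A.

Definition restr_oo (R : realType)
    (mu : {measure set (measurableTypeR R) -> \bar R}) (a b : R) :
    {measure set (measurableTypeR R) -> \bar R} :=
  mrestr mu (measurable_itv `]a, b[).

Definition is_monic_orthopoly (R : realType)
    (mu : {measure set (measurableTypeR R) -> \bar R}) (n : nat)
    (p : {poly R}) : Prop :=
  [/\ p \is monic, size p = n.+1 &
      forall q : {poly R}, (size q <= n)%N ->
        \int[mu]_x (p.[x] * q.[x]) = 0].

(* The orthogonal polynomial of degree n, normalized to be monic. It exists and
   is unique when mu is finite with compact infinite support; the default value
   0 is only used for other measures. *)
Definition orthopoly (R : realType)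
    (mu : {measure set (measurableTypeR R) -> \bar R}) (n : nat) : {poly R} :=
  xget 0 [set p | is_monic_orthopoly mu n p].

(* Each of the distinct real zeros of the n-th orthogonal polynomial has mass
   1/n; for n = 0 there are no zeros, and this is the null measure. *)
Definition zero_counting_measure (R : realType)
    (mu : {measure set (measurableTypeR R) -> \bar R}) (n : nat) :
    {measure set (measurableTypeR R) -> \bar R} :=
  let zs := rootsR (orthopoly mu n) in
  mscale ((n%:R)^-1)%:nng
    (msum (fun i => \d_(zs`_i : measurableTypeR R)) (size zs)).

Definition weak_cvg (R : realType)
    (nu : nat -> {measure set (measurableTypeR R) -> \bar R})
    (nu_oo : {measure set (measurableTypeR R) -> \bar R}) : Prop :=
  forall f : R -> R, continuous f -> bounded_fun f ->
    (\int[nu j]_x (f x)%:E)%E @[j --> \oo] --> (\int[nu_oo]_x (f x)%:E)%E.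

(* Main.v *)
Require Import Defs.
From HB Require Import structures.
From mathcomp Require Import all_boot all_order all_algebra.
From mathcomp Require Import polyrcf ring lra.
From mathcomp Require Import all_classical all_reals all_analysis.
From mathcomp Require Import measurable_realfun.
Import Order.TTheory GRing.Theory Num.Theory numFieldNormedType.Exports.
Local Open Scope classical_set_scope.
Local Open Scope ring_scope.

Set Implicit Arguments.
Unset Strict Implicit.
Unset Printing Implicit Defensive.

(** Why the theorem holds.  Let [L_k] be integration of polynomials against
    [mu_k], and let [K_k(x)] be the diagonal, at degrees below [n], of the
    Christoffel-Darboux (reproducing) kernel of [L_k].  Two facts are combined.

    Monotonicity.  A larger measure has a smaller reproducing kernel on the
    diagonal: [K_2 <= K_1] everywhere ([le_cd_kernel]).  As [mu_1 = mu_2] on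
    the interval, for every test function [f >= 0] vanishing outside it the
    integral of [f K_2] against [mu_2] is at most that of [f K_1] against
    [mu_1].

    Zeros follow the kernel.  For a [C]-Lipschitz [f], the sum of [f] over the
    zeros of the [n]-th orthogonal polynomial [P] differs from the integral of
    [f K] against [mu] by at most [C (e n + M^2 / e)] for every [e > 0], where
    [[-M, M]] carries [mu] ([sum_nodes_near_integral]); divided by [n] this
    vanishes in the limit.  To see it, write [N_z = P / (X - z)] for a zero
    [z].  These polynomials form an orthogonal basis of the polynomials of
    degree below [n], so [K] is the sum of the densities [N_z^2 / L(N_z^2)],
    each of mass one.  The density attached to [z] is concentrated near [z] in
    the mean: the second moments of [x - z] against these densities add up to
    at most [M^2], whatever [n] is ([nodal_spread_le]; the sum is in fact the
    square of a Jacobi coefficient).  Replacing [f(z)] by [f(x)] under each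
    density therefore costs at most [C (e + (x - z)^2 / e)].

    Dividing by [n] and passing to the limit, the integral of [f] against
    [nu_2] is at most that against [nu_1] ([le_integral_weak_limits]).
    Piecewise linear [f] increasing to the indicator of an open interval give
    the inequality between measures of open intervals
    ([measure_itv_oo_le_tent]).  The difference of the two distribution
    functions is then nondecreasing and right-continuous, hence that of a
    Stieltjes measure, which is what [nu_2] lacks to be [nu_1]
    ([measure_le_of_itv_oo]). *)

(** * Orthogonal polynomials of a positive functional *)

Definition positive_functional (R : rcfType) (L : {scalar {poly R}}) :=
  forall p, p != 0 -> (forall x, 0 <= p.[x]) -> 0 < L p.

Definition orthogonal_below (R : rcfType) (L : {scalar {poly R}}) (n : nat)
    (p : {poly R}) :=
  forall q : {poly R}, (size q <= n)%N -> L (p * q) = 0.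

Section PositiveFunctional.
Variables (R : rcfType) (L : {scalar {poly R}}).
Hypothesis L_pos : positive_functional L.

Lemma functional_sqr_gt0 p : p != 0 -> 0 < L (p ^+ 2).
Proof.
move=> p0; apply: L_pos => [|x]; first by rewrite expf_neq0.
by rewrite horner_exp sqr_ge0.
Qed.

Lemma functional_sqr_ge0 p : 0 <= L (p ^+ 2).
Proof.
have [->|/functional_sqr_gt0/ltW//] := eqVneq p 0.
by rewrite expr0n linear0.
Qed.

Let gram n := \matrix_(i < n, j < n) L ('X^i * 'X^j).

Let mul_gramE n (v w : 'rV_n) :
  L (rVpoly v * rVpoly w) = (v *m gram n *m w^T) 0 0.
Proof.
have rVE (u : 'rV[R]_n) : rVpoly u = \sum_(i < n) u 0 i *: 'X^i.
  rewrite /rVpoly poly_def; apply: eq_bigr => i _.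
  by case: insubP => [j _ /val_inj->//|]; rewrite ltn_ord.
rewrite !rVE mulr_sumr linear_sum /= mxE; apply: eq_bigr => j _.
rewrite -scalerAr linearZ /= mulr_suml linear_sum /= !mxE mulrC; congr (_ * _).
by apply: eq_bigr => i _; rewrite -scalerAl linearZ/= mxE.
Qed.

(** The coefficients of the lower-order terms solve a linear system whose matrix
    is the Gram matrix of the monomials; positivity makes it invertible, as a
    kernel vector would be a nonzero polynomial [q] with [L (q ^+ 2) = 0]. *)
Lemma exists_monic_orthogonal n :
  exists p, [/\ p \is monic, size p = n.+1 & orthogonal_below L n p].
Proof.
have gramU : gram n \in unitmx.
  rewrite -row_free_unit -kermx_eq0; apply/eqP/eqP/rowV0P => v.
  move=> /sub_kermxP vG; apply/eqP; apply: contraT => v0.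
  have := @functional_sqr_gt0 (rVpoly v).
  rewrite expr2 mul_gramE vG mul0mx mxE ltxx; apply.
  by apply: contra v0 => /eqP v0; rewrite -[v]rVpolyK v0 linear0.
pose b := \row_(j < n) - L ('X^n * 'X^j).
pose v := b *m invmx (gram n).
have sv : (size (rVpoly v) < size ('X^n : {poly R}))%N.
  by rewrite size_polyXn ltnS size_poly.
exists ('X^n + rVpoly v); split.
- by rewrite monicE lead_coefDl// lead_coefXn.
- by rewrite size_polyDl// size_polyXn.
move=> q qn; rewrite -(poly_rV_K qn) mulrDl linearD /= mul_gramE.
rewrite mulmxKV// mxE.
rewrite {1}/rVpoly poly_def mulr_sumr linear_sum -big_split big1//= => j _.
rewrite -scalerAr linearZ !mxE.
case: insubP => [k _ /val_inj->|]; last by rewrite ltn_ord.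
by rewrite !mxE/= mulNr mulrC subrr.
Qed.

(** Multiplying by [X - z] at each real root [z] of odd multiplicity makes all
    multiplicities even, so that the product no longer changes sign.  The
    induction peels off roots one at a time and toggles their presence in [s],
    which avoids speaking of multiplicities. *)
Lemma exists_semidefinite_multiple (p : {poly R}) : p != 0 ->
  exists s, [/\ uniq s, all (root p) s &
    let q := p * \prod_(z <- s) ('X - z%:P) in
    (forall x, 0 <= q.[x]) \/ (forall x, q.[x] <= 0)].
Proof.
elim: {p}(size p) {-2}p (leqnn (size p)) => [|n IHn] p.
  by rewrite leqn0 size_poly_eq0 => ->.
move=> sp p0.
case rp : (rootsR p) => [|r rs].
  exists [::]; split=> //; rewrite big_nil mulr1 /=.
  have nr x : ~~ root p x.
    apply/negP => px; have := roots_on_rootsR p0 x.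
    by rewrite rp in_nil in_itv /= px.
  have sgn a b : 0 <= p.[a] * p.[b].
    wlog ab : a b / a <= b.
      move=> wl; case: (leP a b) => [/wl//|/ltW/wl].
      by rewrite mulrC.
    rewrite leNgt; apply/negP => /ltW /(polyrcf.poly_ivt ab)[c _].
    exact/negP.
  have [p0ge|p0lt] := leP 0 p.[0]; [left|right] => x.
    by rewrite -(@pmulr_rge0 _ p.[0]) // lt_neqAle p0ge eq_sym nr.
  by rewrite -(@nmulr_rge0 _ p.[0]).
have pr : root p r.
  by have := roots_on_rootsR p0 r; rewrite rp mem_head => /andP[].
have [q pE] := factor_theorem _ _ pr.
have q0 : q != 0 by apply: contraNneq p0 => q0; rewrite pE q0 mul0r.
have sq : (size q <= n)%N.
  by move: sp; rewrite pE size_Mmonic ?monicXsubC // size_XsubC addn2.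
have [s [us sr ss]] := IHn _ sq q0.
have [rs'|rs'] := boolP (r \in s).
  exists (rem r s); split; first exact: rem_uniq.
    apply/allP => x /mem_rem xs; rewrite pE rootM.
    by rewrite (allP sr).
  by move: ss; rewrite (big_rem r) //= pE -mulrA.
exists (r :: s); split; rewrite /= ?rs' // ?pr.
  by apply/allP => x xs; rewrite pE rootM (allP sr).
rewrite big_cons pE mulrACA.
have qE x : (q * ('X - r%:P) * (('X - r%:P) * \prod_(z <- s) ('X - z%:P))).[x]
  = (x - r) ^+ 2 * (q * \prod_(z <- s) ('X - z%:P)).[x].
  by rewrite !hornerM hornerXsubC; ring.
by case: ss => ss; [left|right] => x;
  rewrite qE (mulr_ge0, mulr_ge0_le0) ?sqr_ge0.
Qed.

(** If [p] changed sign at fewer than [n] points, the product of [p] with the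
    corresponding linear factors would be semidefinite and nonzero, yet
    annihilated by [L] by orthogonality. *)
Lemma size_rootsR_orthogonal n p : p \is monic -> size p = n.+1 ->
  orthogonal_below L n p -> size (rootsR p) = n.
Proof.
move=> pm sp op.
have p0 := monic_neq0 pm.
have [s [us sr ss]] := exists_semidefinite_multiple p0.
have ns : (n <= size s)%N.
  rewrite leqNgt; apply/negP => sn.
  have := op (\prod_(z <- s) ('X - z%:P)).
  rewrite size_prod_XsubC => /(_ sn) Lps.
  have q0 : p * \prod_(z <- s) ('X - z%:P) != 0.
    by rewrite mulf_neq0 // monic_neq0 // monic_prod_XsubC.
  case: ss => /= ss.
    by have := L_pos q0 ss; rewrite Lps ltxx.
  have : 0 < L (- (p * \prod_(z <- s) ('X - z%:P))).
    by apply: L_pos => [|x]; rewrite ?oppr_eq0 // hornerN oppr_ge0.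
  by rewrite linearN /= Lps oppr0 ltxx.
have sub : {subset s <= rootsR p}.
  by move=> x xs; rewrite -(roots_on_rootsR p0) in_itv /= (allP sr).
have urp : uniq (rootsR p) by exact: uniq_roots.
apply/eqP; rewrite eqn_leq (leq_trans ns (uniq_leq_size us sub)) andbT.
rewrite -ltnS -sp max_poly_roots //; apply/allP => x.
by rewrite -(roots_on_rootsR p0) => /andP[].
Qed.

Lemma rootsR_prod n p : p \is monic -> size p = n.+1 ->
  orthogonal_below L n p -> p = \prod_(z <- rootsR p) ('X - z%:P).
Proof.
move=> pm sp op; have p0 := monic_neq0 pm.
rewrite {1}[p](@all_roots_prod_XsubC _ _ (rootsR p)).
- by rewrite (monicP pm) scale1r.
- by rewrite (size_rootsR_orthogonal pm sp op).
- by apply/allP => x; rewrite -(roots_on_rootsR p0) => /andP[].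
- by rewrite uniq_rootsE; exact: uniq_roots.
Qed.

End PositiveFunctional.

(** * Nodal polynomials and the Christoffel-Darboux kernel *)

(** Up to a scalar, the Lagrange interpolation polynomial of the node [z]. *)
Definition nodal (R : rcfType) (zs : seq R) z : {poly R} :=
  \prod_(w <- zs | w != z) ('X - w%:P).

Section Quadrature.
Variables (R : rcfType) (L : {scalar {poly R}}).
Hypothesis L_pos : positive_functional L.
Variable zs : seq R.
Hypothesis zs_uniq : uniq zs.
Let P := \prod_(z <- zs) ('X - z%:P).
Hypothesis P_orth : orthogonal_below L (size zs) P.

Local Notation N := (nodal zs).

Definition nodal_mass z := L (N z ^+ 2).

Lemma nodal_monic z : N z \is monic.
Proof. exact: monic_prod_XsubC. Qed.

Lemma nodal_mass_gt0 z : 0 < nodal_mass z.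
Proof.
by apply: functional_sqr_gt0 => //; rewrite monic_neq0 // nodal_monic.
Qed.

Let mass_neq0 z : nodal_mass z != 0.
Proof. by rewrite gt_eqF // nodal_mass_gt0. Qed.

Lemma mul_XsubC_nodal z : z \in zs -> ('X - z%:P) * N z = P.
Proof. by move=> zzs; rewrite /P (bigD1_seq z) //=. Qed.

Lemma size_nodal z : z \in zs -> size (N z) = size zs.
Proof.
move=> zzs; have := size_prod_XsubC zs idfun.
rewrite -/P -(mul_XsubC_nodal zzs) size_monicM ?monicXsubC //.
  by rewrite size_XsubC /= => -[].
by rewrite monic_neq0 // nodal_monic.
Qed.

Lemma size_nodal_comb (c : R -> R) :
  (size (\sum_(z <- zs) c z *: N z)%R <= size zs)%N.
Proof.
rewrite big_seq (leq_trans (size_sum _ _ _)) //.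
apply/bigmax_leqP_seq => z zzs _.
by rewrite (leq_trans (size_scale_leq _ _)) // size_nodal.
Qed.

Lemma nodal_self_neq0 z : (N z).[z] != 0.
Proof.
rewrite /nodal horner_prod prodf_seq_neq0; apply/allP => w _.
by apply/implyP => wz; rewrite hornerXsubC subr_eq0 eq_sym.
Qed.

Lemma nodal_other z w : w \in zs -> w != z -> (N z).[w] = 0.
Proof.
move=> wzs wz; rewrite /nodal (big_rem w) //= wz.
by rewrite hornerM hornerXsubC subrr mul0r.
Qed.

(** Gauss quadrature in disguise: modulo multiples of [X - z] the polynomial [g]
    is a multiple of [N z], and [('X - z) * N z = P] is orthogonal to everything
    of degree below [size zs].  Taking [g := N w] shows that the nodal
    polynomials are orthogonal to each other. *)
Lemma functional_nodal (g : {poly R}) z : (size g <= size zs)%N -> z \in zs ->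
  L (g * N z) = g.[z] / (N z).[z] * nodal_mass z.
Proof.
move=> sg zzs; pose c := g.[z] / (N z).[z].
have : root (g - c *: N z) z.
  by rewrite /root !hornerE /c divfK ?nodal_self_neq0 // subrr.
move=> /factor_theorem[r rE].
have sr : (size r <= size zs)%N.
  have [->|r0] := eqVneq r 0; first by rewrite size_poly0.
  have : (size (r * ('X - z%:P))%R <= size zs)%N.
    rewrite -rE (leq_trans (size_polyD _ _)) // geq_max sg size_polyN.
    by rewrite (leq_trans (size_scale_leq _ _)) // size_nodal.
  by rewrite size_Mmonic ?monicXsubC // size_XsubC addn2; exact: ltnW.
have gE : g = r * ('X - z%:P) + c *: N z by rewrite -rE subrK.
rewrite {1}gE mulrDl linearD /= -[r * _ * _]mulrA mul_XsubC_nodal //.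
by rewrite mulrC P_orth // add0r -scalerAl linearZ /= -expr2.
Qed.

Lemma lagrange_nodal (g : {poly R}) : (size g <= size zs)%N ->
  g = \sum_(z <- zs) (g.[z] / (N z).[z]) *: N z.
Proof.
move=> sg; apply/eqP; rewrite -subr_eq0; apply/negPn/negP => d0.
have := @max_poly_roots _ _ zs d0; rewrite zs_uniq => H.
have {H}: (size zs < size (g - \sum_(z <- zs) (g.[z] / (N z).[z]) *: N z)%R)%N.
  apply: H => //; apply/allP => w wzs.
  rewrite /root hornerD hornerN horner_sum (bigD1_seq w) //=.
  rewrite hornerZ divfK ?nodal_self_neq0 // big1_seq ?addr0 ?subrr //.
  move=> z /andP[zw zzs].
  by rewrite hornerZ (@nodal_other z w) ?mulr0 // eq_sym.
rewrite ltnNge (leq_trans (size_polyD _ _)) // geq_max sg size_polyN.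
exact: size_nodal_comb.
Qed.

(** The reproducing kernel of the polynomials of degree below [size zs], as a
    polynomial in its second variable, expanded in the orthogonal basis of nodal
    polynomials. *)
Definition cd_kernel x : {poly R} :=
  \sum_(z <- zs) ((N z).[x] / nodal_mass z) *: N z.

Lemma size_cd_kernel x : (size (cd_kernel x) <= size zs)%N.
Proof. exact: size_nodal_comb. Qed.

Lemma cd_kernel_reproducing (g : {poly R}) x : (size g <= size zs)%N ->
  L (g * cd_kernel x) = g.[x].
Proof.
move=> sg; rewrite {2}(lagrange_nodal sg) /cd_kernel mulr_sumr linear_sum /=.
rewrite horner_sum !big_seq; apply: eq_bigr => z zzs.
rewrite -scalerAr linearZ /= functional_nodal // hornerZ.
by field; rewrite nodal_self_neq0 mass_neq0.
Qed.

(** Since [('X - z) * N z = P], the sum is [q * L (P ^+ 2)] with [q] the sum of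
    the inverse masses.  The polynomial [Q] below represents the functional that
    extracts the coefficient of degree [(size zs).-1], whence
    [L (Q ^+ 2) = lead_coef Q = q] and [L (P * ('X * Q)) = q * L (P ^+ 2)]:
    up to normalization, [Q] is the orthogonal polynomial of the preceding
    degree.  The bound is then Bessel's inequality for ['X * Q] along [P]. *)
Lemma nodal_spread_le (M : R) :
  (forall p, L (('X * p) ^+ 2) <= M ^+ 2 * L (p ^+ 2)) ->
  \sum_(z <- zs) L ((('X - z%:P) * N z) ^+ 2) / nodal_mass z <= M ^+ 2.
Proof.
move=> Xle; pose Q := \sum_(z <- zs) (nodal_mass z)^-1 *: N z.
pose q := \sum_(z <- zs) (nodal_mass z)^-1.
have -> : \sum_(z <- zs) L ((('X - z%:P) * N z) ^+ 2) / nodal_mass z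
    = q * L (P ^+ 2).
  rewrite /q mulr_suml !big_seq; apply: eq_bigr => z zzs.
  by rewrite mul_XsubC_nodal // mulrC.
have sQ : (size Q <= size zs)%N by exact: size_nodal_comb.
have LQQ : L (Q ^+ 2) = q.
  rewrite expr2 {2}/Q mulr_sumr linear_sum /q /= !big_seq.
  apply: eq_bigr => z zzs.
  rewrite -scalerAr linearZ /= functional_nodal // /Q horner_sum.
  rewrite (bigD1_seq z) //= big1_seq ?addr0 => [|w /andP[wz wzs]]; last first.
    by rewrite hornerZ (@nodal_other w z) ?mulr0 // eq_sym.
  by rewrite hornerZ mulfK ?nodal_self_neq0 // mulVf // mulr1.
have q_ge0 : 0 <= q by rewrite -LQQ functional_sqr_ge0.
have LPXQ : L (P * ('X * Q)) = q * L (P ^+ 2).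
  pose h := \sum_(z <- zs) (z / nodal_mass z) *: N z.
  (* the terms of degree [size zs] of ['X * Q] and [q *: P] agree *)
  have -> : 'X * Q = q *: P + h.
    rewrite /Q /q /h scaler_suml mulr_sumr -big_split /= !big_seq.
    apply: eq_bigr => z zzs; rewrite -(mul_XsubC_nodal zzs) -!mul_polyC polyCM.
    ring.
  have sh : (size h <= size zs)%N by exact: size_nodal_comb.
  by rewrite mulrDr linearD /= -scalerAr linearZ /= -expr2 (P_orth sh) addr0.
have : 0 <= L ((q *: P - 'X * Q) ^+ 2) by exact: functional_sqr_ge0.
have -> : (q *: P - 'X * Q) ^+ 2 =
    (q ^+ 2) *: P ^+ 2 - (q *+ 2) *: (P * ('X * Q)) + ('X * Q) ^+ 2.
  rewrite -!mul_polyC rmorphXn rmorphMn /=; ring.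
have LZ a p : L (a *: p) = a * L p by rewrite linearZ.
rewrite linearD linearB /= !LZ LPXQ => h.
have := Xle Q; rewrite LQQ => h2.
have {h h2} h : q * (q * L (P ^+ 2)) <= q * M ^+ 2 by lra.
have [q0|q0] := eqVneq q 0; first by rewrite q0 mul0r sqr_ge0.
by rewrite -(ler_pM2l (_ : 0 < q)) // lt_neqAle eq_sym q0.
Qed.

End Quadrature.

(** The diagonal of the kernel is itself a polynomial, which makes its integrals
    values of [L]. *)
Definition cd_diag (R : rcfType) (L : {scalar {poly R}}) (zs : seq R) :
    {poly R} :=
  \sum_(z <- zs) (nodal_mass L zs z)^-1 *: nodal zs z ^+ 2.

Lemma cd_diagE (R : rcfType) (L : {scalar {poly R}}) (zs : seq R) x :
  (cd_diag L zs).[x] = (cd_kernel L zs x).[x].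
Proof.
rewrite /cd_kernel /cd_diag !horner_sum; apply: eq_bigr => z _.
by rewrite !hornerZ horner_exp expr2 mulrCA mulrA.
Qed.

(** Expanding [0 <= L1 ((k2 - k1) ^+ 2)] by the reproducing property of [k1], and
    bounding [L1 (k2 ^+ 2)] by [L2 (k2 ^+ 2) = k2.[x]], leaves exactly
    [0 <= k1.[x] - k2.[x]]. *)
Lemma le_cd_kernel (R : rcfType) (L1 L2 : {scalar {poly R}}) (zs1 zs2 : seq R) :
  positive_functional L1 -> positive_functional L2 ->
  (forall p, L1 (p ^+ 2) <= L2 (p ^+ 2)) ->
  uniq zs1 -> uniq zs2 -> size zs1 = size zs2 ->
  orthogonal_below L1 (size zs1) (\prod_(z <- zs1) ('X - z%:P)) ->
  orthogonal_below L2 (size zs2) (\prod_(z <- zs2) ('X - z%:P)) ->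
  forall x, (cd_kernel L2 zs2 x).[x] <= (cd_kernel L1 zs1 x).[x].
Proof.
move=> L1_pos L2_pos L12 u1 u2 s12 o1 o2 x.
set k1 := cd_kernel L1 zs1 x; set k2 := cd_kernel L2 zs2 x.
have s1 : (size k1 <= size zs1)%N by exact: size_cd_kernel.
have s2 : (size k2 <= size zs1)%N by rewrite s12; exact: size_cd_kernel.
have : 0 <= L1 ((k2 - k1) ^+ 2) by exact: functional_sqr_ge0.
have -> : (k2 - k1) ^+ 2 = k2 ^+ 2 - (k2 * k1) *+ 2 + k1 * k1 by ring.
rewrite linearD linearB linearMn /= !cd_kernel_reproducing //.
have L2k : L2 (k2 ^+ 2) = k2.[x] by rewrite expr2 cd_kernel_reproducing // -s12.
by have := L12 k2; rewrite L2k; lra.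
Qed.

(** * Moments of a measure with bounded support *)

(** Every point off the support lies in a null interval with rational endpoints,
    and there are countably many of those. *)
Lemma measure_off_support (R : realType)
    (mu : {measure set (measurableTypeR R) -> \bar R}) (A : set R) :
  measurable (A : set (measurableTypeR R)) -> A `&` measure_support mu = set0 ->
  mu A = 0%E.
Proof.
move=> mA A0; apply: measure_negligible => //.
pose I (r : rat * rat) : set R := `](ratr r.1), (ratr r.2)[%classic.
pose F n : set (measurableTypeR R) := if unpickle n is Some r then
  if mu (I r) == 0%E then I r else set0 else set0.
apply: (@negligibleS _ _ _ _ (\bigcup_n F n)); last first.
  apply: negligible_bigcup => n; rewrite /F.
  case: unpickle => [r|]; last exact: negligible_set0.
  case: ifPn => [/eqP m0|_]; last exact: negligible_set0.
  by apply/negligibleP => //; exact: measurable_itv.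
move=> x Ax.
have : ~ measure_support mu x.
  by move=> sx; have : (set0 : set R) x by rewrite -A0.
rewrite /measure_support /=.
move=> /existsNP[U /not_implyP[oU /not_implyP[Ux /negP]]].
rewrite -leNgt measure_le0 => /eqP U0.
have /nbhs_ballP[e /= e0 eU] : nbhs x U by exact: open_nbhs_nbhs.
have [p xp] : exists q : rat, x - e < ratr q < x.
  have [q] := @rat_in_itvoo R (x - e) x (ltac:(lra)).
  by rewrite in_itv => h; exists q.
have [q xq] : exists q : rat, x < ratr q < x + e.
  have [q] := @rat_in_itvoo R x (x + e) (ltac:(lra)).
  by rewrite in_itv => h; exists q.
have IU : I (p, q) `<=` U.
  move=> y; rewrite /I /= in_itv /= => /andP[py yq]; apply: eU.
  by rewrite /ball /= ltr_norml; lra.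
have I0 : mu (I (p, q)) = 0%E.
  apply/eqP; rewrite -measure_le0 -U0 le_measure ?inE //.
    exact: measurable_itv.
  exact: open_measurable.
have FE : F (pickle (p, q)) = I (p, q) by rewrite /F pickleK I0 eqxx.
exists (pickle (p, q)); first exact: Logic.I.
by rewrite FE /I /= in_itv /=; lra.
Qed.

Lemma compact_support_bounded (R : realType)
    (mu : {measure set (measurableTypeR R) -> \bar R}) :
  compact (measure_support mu) ->
  \forall M \near +oo, mu (~` `[- M, M]) = 0%E.
Proof.
move=> /(@compact_bounded R R^o)[B [_ hB]].
exists B; split; rewrite ?num_real // => M BM.
apply: measure_off_support.
  by apply: measurableC; exact: measurable_itv.
rewrite -subset0 => x [/= xM sx]; apply: xM.
by rewrite in_itv /= -ler_norml; exact: (hB _ BM).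
Qed.

Section BoundedSupport.
Variables (R : realType).
Variable mu : {finite_measure set (measurableTypeR R) -> \bar R}.
Variable M : R.
Hypothesis muM : mu (~` `[- M, M]) = 0%E.

Let K : set (measurableTypeR R) := `[- M, M]%classic.
Let mK : measurable K. Proof. exact: measurable_itv. Qed.

Lemma continuous_integrable (f : R -> R) : continuous f ->
  mu.-integrable setT (EFin \o f).
Proof.
move=> cf.
have mf : measurable_fun setT (f : measurableTypeR R -> R).
  exact: continuous_measurable_fun.
apply/(negligible_integrable (measurableC mK)) => //.
  exact/measurable_EFinP.
rewrite setTD setCK.
apply: measurable_bounded_integrable => //.
- by rewrite -ge0_fin_numE // fin_num_measure.
- exact: measurable_funTS.
have /compact_bounded[N [_ hN]] : compact (f @` `[- M, M]).
  apply: continuous_compact; first exact: continuous_subspaceT.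
  exact: segment_compact.
by exists N; split; rewrite ?num_real // => ? ? ? ?; exact: hN.
Qed.

Lemma Rintegral_bounded_support (f : R -> R) : continuous f ->
  \int[mu]_x f x = \int[mu]_(x in K) f x.
Proof.
move=> cf; rewrite /Rintegral (negligible_integral (measurableC mK)) //.
  by rewrite setTD setCK.
exact: continuous_integrable.
Qed.

Lemma le_Rintegral_bounded_support (f g : R -> R) :
  continuous f -> continuous g ->
  (forall x, `|x| <= M -> f x <= g x) -> \int[mu]_x f x <= \int[mu]_x g x.
Proof.
move=> cf cg fg; rewrite !Rintegral_bounded_support //.
apply: le_Rintegral => //.
- by apply: (@integrableS _ _ _ _ setT) => //; exact: continuous_integrable.
- by apply: (@integrableS _ _ _ _ setT) => //; exact: continuous_integrable.
by move=> x; rewrite /K /= in_itv /= -ler_norml; exact: fg.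
Qed.

(** A linear structure on integration of polynomials is only available once all
    of them are integrable, hence the existential form. *)
Lemma exists_moment_functional :
  exists L : {scalar {poly R}}, forall p, L p = \int[mu]_x p.[x].
Proof.
pose f (p : {poly R}) : R^o := \int[mu]_x p.[x].
have fin (p : {poly R}) : mu.-integrable setT (EFin \o horner p).
  by apply: continuous_integrable; exact: continuous_horner.
have lf : linear f.
  move=> a p q; rewrite /f.
  under eq_Rintegral do rewrite hornerD hornerZ.
  rewrite RintegralD // ?RintegralZl //.
  have := fin (a *: p); congr (_.-integrable _ _).
  by apply/funext => x /=; rewrite hornerZ.
pose g := HB.pack_for {scalar {poly R}} f
  (GRing.isLinear.Build R {poly R} R^o _ f lf).
by exists g.
Qed.

Variable L : {scalar {poly R}}.
Hypothesis LE : forall p, L p = \int[mu]_x p.[x].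

(** A nonzero polynomial has finitely many roots, so it is positive at some point
    of an infinite support, and bounded below on a neighbourhood of that point,
    which has positive measure. *)
Lemma moment_functional_positive :
  infinite_set (measure_support mu) -> positive_functional L.
Proof.
move=> inf p p0 pge; rewrite LE.
have [x sx px] : exists2 x, measure_support mu x & 0 < p.[x].
  apply: contrapT => nx; apply: inf.
  apply: (@sub_finite_set _ _ [set` rootsR p]); last exact: finite_seq.
  move=> x sx /=; rewrite -(roots_on_rootsR p0) in_itv /= /root.
  apply: contrapT => px; apply: nx; exists x => //.
  by rewrite lt_neqAle pge eq_sym andbT; apply/negP.
pose U := [set y | p.[x] / 2 < p.[y]].
have oU : open U.
  apply: (@open_comp _ _ (horner p) [set y | p.[x] / 2 < y]);
    last exact: open_gt.
  by move=> y _; exact: continuous_horner.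
have mU : measurable (U : set (measurableTypeR R)) by exact: open_measurable.
have Upos : (0 < mu U)%E by apply: sx => //; rewrite /U /=; lra.
have Ufin : mu U \is a fin_num by exact: fin_num_measure.
apply: (@lt_le_trans _ _ (\int[mu]_(y in U) (p.[x] / 2))).
  rewrite Rintegral_cst // mulr_gt0 ?divr_gt0 //.
  by rewrite fine_gt0 // Upos -ge0_fin_numE.
have ip := continuous_integrable (@continuous_horner _ p).
apply: (@le_trans _ _ (\int[mu]_(y in U) p.[y])).
  apply: le_Rintegral => //.
  - exact: finite_measure_integrable_cst.
  - exact: integrableS ip.
  by move=> y /ltW.
rewrite Rintegral_mkcond; apply: le_Rintegral => //.
  have /(integrable_mkcond _ mU) : mu.-integrable U (EFin \o horner p).
    exact: integrableS ip.
  by congr (_.-integrable _ _); rewrite restrict_EFin.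
by move=> y _; rewrite patchE; case: ifP.
Qed.

Lemma moment_functional_mulX_le p : L (('X * p) ^+ 2) <= M ^+ 2 * L (p ^+ 2).
Proof.
have -> : M ^+ 2 * L (p ^+ 2) = L (M ^+ 2 *: p ^+ 2) by rewrite linearZ.
rewrite !LE; apply: le_Rintegral_bounded_support; try exact: continuous_horner.
move=> x xM; rewrite hornerZ !horner_exp hornerM hornerX exprMn.
rewrite ler_wpM2r ?sqr_ge0 //.
by rewrite -(real_normK (num_real x)) lerXn2r // nnegrE ?(le_trans _ xM).
Qed.

End BoundedSupport.

(** * Sums over the zeros and integrals against the kernel *)

Lemma lipschitz_continuous (R : realType) (f : R -> R) (C : R) :
  (forall x y, `|f x - f y| <= C * `|x - y|) -> continuous f.
Proof.
move=> lf x; apply/cvgrPdist_lt => e e0.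
have C0 : 0 <= C.
  by have := lf 1 0; rewrite subr0 normr1 mulr1; apply: le_trans.
have C1 : 0 < C + 1 by rewrite ltr_wpDl.
near=> y.
apply: (le_lt_trans (lf x y)); apply: (@le_lt_trans _ _ ((C + 1) * `|x - y|)).
  by rewrite ler_wpM2r // lerDl.
rewrite mulrC -ltr_pdivlMr //.
near: y; apply/nbhs_ballP; exists (e / (C + 1)) => //=; exact: divr_gt0.
Unshelve. all: by end_near. Qed.

(** The elementary inequality [t <= e + t ^+ 2 / e] turns a Lipschitz bound into
    a quadratic one, which the spread of the nodal densities controls. *)
Lemma lipschitz_defect_le (R : realFieldType) (f : R -> R) (C e : R) :
  0 < e -> (forall x y, `|f x - f y| <= C * `|x - y|) ->
  forall x z, `|f z - f x| <= C * (e + e^-1 * (x - z) ^+ 2).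
Proof.
move=> e0 lf x z; have C0 : 0 <= C.
  by have := lf 1 0; rewrite subr0 normr1 mulr1; apply: le_trans.
rewrite distrC (le_trans (lf _ _)) // ler_wpM2l //.
rewrite -(ler_pM2l e0) mulrDr mulrA divff ?gt_eqF // mul1r.
rewrite -(real_normK (num_real (x - z))).
set t := `|x - z|; have : 0 <= (t - e) ^+ 2 by exact: sqr_ge0.
have : 0 <= t by exact: normr_ge0.
nra.
Qed.

Section NodesVersusKernel.
Variables (R : realType).
Variable mu : {finite_measure set (measurableTypeR R) -> \bar R}.
Variable M : R.
Hypothesis muM : mu (~` `[- M, M]) = 0%E.
Variable L : {scalar {poly R}}.
Hypothesis LE : forall p, L p = \int[mu]_x p.[x].
Hypothesis L_pos : positive_functional L.
Variable zs : seq R.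
Hypothesis zs_uniq : uniq zs.
Hypothesis zs_orth : orthogonal_below L (size zs) (\prod_(z <- zs) ('X - z%:P)).

Local Notation N := (nodal zs).
Local Notation kap := (nodal_mass L zs).

(** The sum on the left is [L G], where the polynomial [G] is [cd_diag] with each
    nodal density weighted by the value of [f] at its node.  Hence it suffices to
    compare [G] with [f * cd_diag] pointwise and to integrate the polynomial
    bound [E] on their difference. *)
Lemma sum_nodes_near_integral (f : R -> R) (C e : R) : 0 < e ->
  (forall x y, `|f x - f y| <= C * `|x - y|) ->
  `|\sum_(z <- zs) f z - \int[mu]_x (f x * (cd_diag L zs).[x])|
    <= C * (e * (size zs)%:R + e^-1 * M ^+ 2).
Proof.
move=> e0 lf; have cf := lipschitz_continuous lf; have C0 : 0 <= C.
  by have := lf 1 0; rewrite subr0 normr1 mulr1; apply: le_trans.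
pose G := \sum_(z <- zs) (f z / kap z) *: N z ^+ 2.
pose S := \sum_(z <- zs) (kap z)^-1 *: (('X - z%:P) * N z) ^+ 2.
pose E := C *: (e *: cd_diag L zs + e^-1 *: S).
have kap0 z : kap z != 0 by rewrite gt_eqF // nodal_mass_gt0.
have LG : L G = \sum_(z <- zs) f z.
  rewrite linear_sum; apply: eq_bigr => z _.
  by rewrite linearZ /= -/(kap z) divfK.
have LEle : L E <= C * (e * (size zs)%:R + e^-1 * M ^+ 2).
  rewrite !(linearZ, linearD) /= ler_wpM2l // lerD //.
    rewrite ler_pM2l // /cd_diag linear_sum /= -sum1_size natr_sum.
    by apply: ler_sum => z _; rewrite linearZ /= -/(kap z) mulVf.
  rewrite ler_pM2l ?invr_gt0 //.
  apply: le_trans (nodal_spread_le L_pos zs_uniq zs_orth _); last first.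
    by move=> p; apply: (moment_functional_mulX_le muM LE).
  rewrite /S linear_sum /=; apply: ler_sum => z _.
  by rewrite linearZ /= mulrC.
have GE x : `|G.[x] - f x * (cd_diag L zs).[x]| <= E.[x].
  rewrite /G /E /S /cd_diag !(hornerZ, hornerD, horner_sum).
  rewrite !mulr_sumr -sumrB -big_split /= mulr_sumr.
  rewrite (le_trans (ler_norm_sum _ _ _)) //; apply: ler_sum => z _.
  rewrite !hornerZ !horner_exp hornerM hornerXsubC.
  have k0 : 0 < kap z by exact: nodal_mass_gt0.
  have -> : f z / kap z * (N z).[x] ^+ 2 - f x * ((kap z)^-1 * (N z).[x] ^+ 2)
     = (f z - f x) * ((kap z)^-1 * (N z).[x] ^+ 2) by ring.
  rewrite normrM [X in _ * X]ger0_norm; last first.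
    by rewrite mulr_ge0 ?sqr_ge0 // invr_ge0 ltW.
  have -> : C * (e * ((kap z)^-1 * (N z).[x] ^+ 2) +
                e^-1 * ((kap z)^-1 * ((x - z) * (N z).[x]) ^+ 2)) =
    C * (e + e^-1 * (x - z) ^+ 2) * ((kap z)^-1 * (N z).[x] ^+ 2) by ring.
  rewrite ler_wpM2r ?lipschitz_defect_le //.
  by rewrite mulr_ge0 ?sqr_ge0 // invr_ge0 ltW.
have cfK : continuous (fun x => f x * (cd_diag L zs).[x]).
  by move=> x; apply: cvgM; [exact: cf|exact: continuous_horner].
have iP (p : {poly R}) : mu.-integrable setT (EFin \o horner p).
  by apply: (continuous_integrable muM); exact: continuous_horner.
have ifK := continuous_integrable muM cfK.
have dE : L G - \int[mu]_x (f x * (cd_diag L zs).[x]) =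
   \int[mu]_x (G.[x] - f x * (cd_diag L zs).[x]) by rewrite LE RintegralB.
rewrite -LG dE.
have cD : continuous (fun x => G.[x] - f x * (cd_diag L zs).[x]).
  by move=> x; apply: cvgB; [exact: continuous_horner|exact: cfK].
have iD := continuous_integrable muM cD.
apply: le_trans LEle; apply: (le_trans (le_normr_Rintegral _ iD)) => //.
rewrite LE; apply: le_Rintegral => //.
exact: integrable_norm.
Qed.

End NodesVersusKernel.

(** * Comparison of the zeros for two measures *)

Lemma orthopoly_zeros (R : realType)
    (mu : {measure set (measurableTypeR R) -> \bar R}) (L : {scalar {poly R}})
    (LE : forall p, L p = \int[mu]_x p.[x]) (L_pos : positive_functional L) n :
  let zs := rootsR (orthopoly mu n) in
  [/\ uniq zs, size zs = n &
      orthogonal_below L (size zs) (\prod_(z <- zs) ('X - z%:P))].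
Proof.
have intM (p q : {poly R}) : \int[mu]_x (p.[x] * q.[x]) = L (p * q).
  by rewrite LE; apply: eq_Rintegral => x _; rewrite hornerM.
have [pm sp po] : is_monic_orthopoly mu n (orthopoly mu n).
  have [p [pm sp po]] := exists_monic_orthogonal L_pos n.
  apply: (@xgetPex _ 0 [set p | is_monic_orthopoly mu n p]).
  by exists p; split=> // q /po; rewrite intM.
have {}po : orthogonal_below L n (orthopoly mu n).
  by move=> q /po; rewrite intM.
split; first exact: uniq_roots.
  exact: size_rootsR_orthogonal po.
rewrite (size_rootsR_orthogonal L_pos pm sp po).
by rewrite -(rootsR_prod L_pos pm sp po).
Qed.

Lemma integral_zero_counting (R : realType)
    (mu : {measure set (measurableTypeR R) -> \bar R}) n (f : R -> R) :
  measurable_fun setT (f : measurableTypeR R -> R) -> (forall x, 0 <= f x) ->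
  (\int[zero_counting_measure mu n]_x (f x)%:E =
    (n%:R^-1 * \sum_(z <- rootsR (orthopoly mu n)) f z)%:E)%E.
Proof.
move=> mf f0.
have mEf : measurable_fun setT (EFin \o (f : measurableTypeR R -> R)).
  exact/measurable_EFinP.
rewrite /zero_counting_measure ge0_integral_mscale //; last first.
  by move=> x _; rewrite lee_fin.
rewrite ge0_integral_measure_sum //; last by move=> x _; rewrite lee_fin.
rewrite EFinM; congr (_ * _)%E.
rewrite (big_nth 0) big_mkord -sumEFin; apply: eq_bigr => i _.
by rewrite integral_dirac // diracT mul1e.
Qed.

Section CompareMeasures.
Variables (R : realType).
Variables (mu1 mu2 : {finite_measure set (measurableTypeR R) -> \bar R}).
Variables (alpha beta : R).
Hypothesis mu1_infinite : infinite_set (measure_support mu1).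
Hypothesis mu2_infinite : infinite_set (measure_support mu2).
Hypothesis mu_le : measure_le mu1 mu2.
Hypothesis mu_eq :
  measure_eq (restr_oo mu1 alpha beta) (restr_oo mu2 alpha beta).
Variable M : R.
Hypothesis mu1M : mu1 (~` `[- M, M]) = 0%E.
Hypothesis mu2M : mu2 (~` `[- M, M]) = 0%E.

Lemma Rintegral_eq_on (f : R -> R) :
  (forall x, x \notin `]alpha, beta[ -> f x = 0) ->
  \int[mu1]_x f x = \int[mu2]_x f x.
Proof.
move=> f0; pose D : set (measurableTypeR R) := `]alpha, beta[%classic.
have fD : f = f \_ D.
  apply/funext => x; rewrite patchE; case: ifPn => // xD.
  by apply: f0; apply: contra xD => xD; rewrite inE.
rewrite fD -!Rintegral_mkcond /Rintegral; congr fine.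
apply: eq_measure_integral => A mA AD.
have rE (m : {measure set (measurableTypeR R) -> \bar R}) :
  restr_oo m alpha beta A = m A by rewrite /= /mrestr setIidl.
by rewrite -(rE mu1) -(rE mu2); exact: mu_eq.
Qed.

Lemma le_Rintegral_measure (f : R -> R) :
  continuous f -> (forall x, 0 <= f x) ->
  \int[mu1]_x f x <= \int[mu2]_x f x.
Proof.
move=> cf f0; apply: fine_le.
- exact: integrable_fin_num (continuous_integrable mu1M cf).
- exact: integrable_fin_num (continuous_integrable mu2M cf).
apply: ge0_le_measure_integral => //.
by apply/measurable_EFinP; exact: continuous_measurable_fun.
Qed.

(** Both sums are close to integrals of [f] times a kernel, and these are ordered:
    the measures may be exchanged under [f], which vanishes where they differ,
    and the kernel of the larger measure is the smaller one. *)
Lemma sum_zeros_compare (f : R -> R) (C e : R) (n : nat) : 0 < e ->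
  (forall x y, `|f x - f y| <= C * `|x - y|) ->
  (forall x, 0 <= f x) -> (forall x, x \notin `]alpha, beta[ -> f x = 0) ->
  \sum_(z <- rootsR (orthopoly mu2 n)) f z <=
  \sum_(z <- rootsR (orthopoly mu1 n)) f z + 2 * C * (e * n%:R + e^-1 * M ^+ 2).
Proof.
have triangle (a b c d E : R) :
    `|a - b| <= E -> `|c - d| <= E -> b <= d -> a <= c + E + E.
  by rewrite !ler_norml; lra.
move=> e0 lf f_ge0 f_off; have cf := lipschitz_continuous lf.
have [L1 L1E] := exists_moment_functional mu1M.
have [L2 L2E] := exists_moment_functional mu2M.
have L1_pos := moment_functional_positive mu1M L1E mu1_infinite.
have L2_pos := moment_functional_positive mu2M L2E mu2_infinite.
have [u1 s1 o1] := orthopoly_zeros L1E L1_pos n.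
have [u2 s2 o2] := orthopoly_zeros L2E L2_pos n.
have near1 := sum_nodes_near_integral mu1M L1E L1_pos u1 o1 e0 lf.
have near2 := sum_nodes_near_integral mu2M L2E L2_pos u2 o2 e0 lf.
rewrite s1 in near1; rewrite s2 in near2.
rewrite -Rintegral_eq_on in near2 => [|x /f_off ->]; last by rewrite mul0r.
rewrite -mulrA mulrDl mul1r addrA; apply: triangle near2 near1 _.
have cfK (p : {poly R}) : continuous (fun x => f x * p.[x]).
  by move=> x; apply: cvgM; [exact: cf|exact: continuous_horner].
apply: (le_Rintegral_bounded_support mu1M) => // x _.
rewrite ler_wpM2l // !cd_diagE le_cd_kernel //; last by rewrite s1.
move=> p; rewrite L1E L2E; apply: le_Rintegral_measure.
  exact: continuous_horner.
by move=> y; rewrite horner_exp sqr_ge0.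
Qed.

Variables (n : nat -> nat).
Variables (nu1 nu2 : {finite_measure set (measurableTypeR R) -> \bar R}).
Hypothesis n_oo : n @ \oo --> \oo.
Hypothesis nu1_lim : weak_cvg (fun j => zero_counting_measure mu1 (n j)) nu1.
Hypothesis nu2_lim : weak_cvg (fun j => zero_counting_measure mu2 (n j)) nu2.

Lemma le_integral_weak_limits (f : R -> R) (C : R) :
  bounded_fun f -> (forall x y, `|f x - f y| <= C * `|x - y|) ->
  (forall x, 0 <= f x) -> (forall x, x \notin `]alpha, beta[ -> f x = 0) ->
  (\int[nu2]_x (f x)%:E <= \int[nu1]_x (f x)%:E)%E.
Proof.
move=> bf lf f_ge0 f_off; have cf := lipschitz_continuous lf.
have C0 : 0 <= C.
  by have := lf 1 0; rewrite subr0 normr1 mulr1; apply: le_trans.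
have mf : measurable_fun setT (f : measurableTypeR R -> R).
  exact: continuous_measurable_fun.
apply/lee_addgt0Pr => e e0.
(* [d] is the free parameter of the comparison of sums: its error, divided by
   [n j], is at most [4 * C * d < e] as soon as [M ^+ 2 / d <= d * n j] *)
pose d := e / (4 * C + 1).
have d0 : 0 < d by rewrite divr_gt0 //; lra.
have lim1 : (\int[zero_counting_measure mu1 (n j)]_x (f x)%:E + e%:E)%E
    @[j --> \oo] --> (\int[nu1]_x (f x)%:E + e%:E)%E.
  apply: cvgeD; [|exact: nu1_lim|exact: cvg_cst].
  by rewrite fin_num_adde_defl.
apply: (lee_cvg_to (nu2_lim cf bf) lim1).
have [k kM] : exists k : nat, d^-1 * (d^-1 * M ^+ 2) <= k%:R.
  exists (Num.bound (d^-1 * (d^-1 * M ^+ 2))).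
  have d1 : 0 <= d^-1 by rewrite invr_ge0 ltW.
  by apply/ltW/archi_boundP; rewrite mulr_ge0 // mulr_ge0 // sqr_ge0.
near=> j.
have nk : (k < n j)%N by near: j; exact: n_oo (nbhs_infty_gt k).
have n0 : 0 < (n j)%:R :> R by rewrite ltr0n (leq_ltn_trans _ nk).
rewrite !integral_zero_counting // -EFinD lee_fin.
rewrite -(ler_pM2l n0) mulrDr !mulVKf ?gt_eqF //.
apply: le_trans (sum_zeros_compare (n j) d0 lf f_ge0 f_off) _.
rewrite lerD2l.
have dM : d^-1 * M ^+ 2 <= d * (n j)%:R.
  rewrite -(ler_pM2l (_ : 0 < d^-1)) ?invr_gt0 // mulKf ?gt_eqF //.
  by rewrite (le_trans kM) // ler_nat ltnW.
apply: (@le_trans _ _ (2 * C * (d * (n j)%:R + d * (n j)%:R))).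
  by rewrite ler_wpM2l ?lerD2l // mulr_ge0.
have -> : 2 * C * (d * (n j)%:R + d * (n j)%:R) = (n j)%:R * (4 * C * d).
  by ring.
rewrite ler_pM2l // /d mulrA ler_pdivrMr; last by lra.
by rewrite mulrC ler_pM2l //; lra.
Unshelve. all: by end_near. Qed.

End CompareMeasures.

(** * From Lipschitz test functions to open intervals *)

Section Tent.
Variable R : realType.

Definition tent (a b k x : R) : R :=
  Num.max 0 (Num.min 1 (Num.min (k * (x - a)) (k * (b - x)))).

Lemma tent_ge0 a b k x : 0 <= tent a b k x.
Proof. by rewrite le_max lexx. Qed.

Lemma tent_le1 a b k x : tent a b k x <= 1.
Proof. by rewrite ge_max ler01 ge_min lexx. Qed.

Lemma tent_off a b k x : 0 <= k -> x \notin `]a, b[ -> tent a b k x = 0.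
Proof.
move=> k0; rewrite in_itv /= negb_and -!leNgt => ab; apply/max_idPl.
rewrite !ge_min; case/orP: ab => h; apply/orP; right; apply/orP; [left|right];
  by rewrite mulr_ge0_le0 // subr_le0.
Qed.

Lemma tent_eq1 a b k x :
  0 < k -> x \in `[a + k^-1, b - k^-1] -> tent a b k x = 1.
Proof.
move=> k0; rewrite in_itv /= => /andP[ax xb].
rewrite /tent min_l ?max_r // le_min -!ler_pdivrMl // mulr1.
by rewrite lerBrDr addrC ax lerBrDr addrC -lerBrDr.
Qed.

Lemma tent_lipschitz a b k : 0 <= k ->
  forall x y, `|tent a b k x - tent a b k y| <= k * `|x - y|.
Proof.
move=> k0 x y.
have lmax (u u' v v' d : R) : `|u - u'| <= d -> `|v - v'| <= d ->
    `|Num.max u v - Num.max u' v'| <= d.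
  by case: (leP u v); case: (leP u' v'); rewrite !ler_norml; lra.
have lmin (u u' v v' d : R) : `|u - u'| <= d -> `|v - v'| <= d ->
    `|Num.min u v - Num.min u' v'| <= d.
  by case: (leP u v); case: (leP u' v'); rewrite !ler_norml; lra.
have d0 : 0 <= k * `|x - y| by rewrite mulr_ge0.
apply: (lmax); first by rewrite subrr normr0.
apply: (lmin); first by rewrite subrr normr0.
apply: (lmin); rewrite -mulrBr normrM (ger0_norm k0) ler_wpM2l //.
  by have -> : x - a - (y - a) = x - y by ring.
have -> : b - x - (b - y) = - (x - y) by ring.
by rewrite normrN.
Qed.

Lemma tent_continuous a b k : 0 <= k -> continuous (tent a b k).
Proof. by move=> k0; exact: lipschitz_continuous (tent_lipschitz a b k0). Qed.

(** The trapezoids are squeezed between the indicators of the closed intervals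
    [[a + 1/k, b - 1/k]], which exhaust [(a, b)], and that of [(a, b)]; so
    continuity of [m2] from below suffices. *)
Lemma measure_itv_oo_le_tent
    (m1 m2 : {finite_measure set (measurableTypeR R) -> \bar R}) (a b : R) :
  (forall n : nat, (\int[m2]_x (tent a b n.+1%:R x)%:E <=
                    \int[m1]_x (tent a b n.+1%:R x)%:E)%E) ->
  (m2 `]a, b[%classic <= m1 `]a, b[%classic)%E.
Proof.
move=> h; pose F (n : nat) : set (measurableTypeR R) :=
  `[a + n.+1%:R^-1, b - n.+1%:R^-1]%classic.
have mt n : measurable_fun setT (tent a b n.+1%:R : measurableTypeR R -> R).
  by apply: continuous_measurable_fun; exact: tent_continuous.
have mF : forall n, measurable (F n) by move=> n; exact: measurable_itv.
have mab : measurable (`]a, b[%classic : set (measurableTypeR R)).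
  exact: measurable_itv.
have UF : \bigcup_n F n = `]a, b[%classic.
  apply/seteqP; split=> x.
    move=> [n _]; rewrite /F /= !in_itv /=.
    have : 0 < n.+1%:R^-1 :> R by rewrite invr_gt0.
    by set u := _^-1; lra.
  rewrite /= in_itv /= => /andP[ax xb].
  pose d := Num.min (x - a) (b - x).
  have d0 : 0 < d by rewrite lt_min !subr_gt0 ax.
  exists (Num.bound d^-1) => //; rewrite /F /= in_itv /=.
  have : (Num.bound d^-1).+1%:R^-1 <= d.
    rewrite invf_ple ?posrE ?ltr0n // ltW // (lt_trans (archi_boundP _)) //.
      by rewrite invr_ge0 ltW.
    by rewrite ltr_nat.
  by rewrite le_min; set u := _^-1; lra.
rewrite -UF; apply: (cvge_le _ (nondecreasing_cvg_mu _ _ _)) => //; last 2 first.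
- by rewrite UF.
- move=> n p np; apply/subsetPset => x; rewrite /F /= !in_itv /=.
  have : p.+1%:R^-1 <= n.+1%:R^-1 :> R.
    by rewrite lef_pV2 ?posrE ?ltr0n // ler_nat.
  by set u := _^-1; set v := n.+1%:R^-1; lra.
near=> n; rewrite UF /=.
have iE (m : {finite_measure set (measurableTypeR R) -> \bar R})
    (A : set (measurableTypeR R)) :
  measurable A -> m A = (\int[m]_x (\1_A x)%:E)%E.
  by move=> mA; rewrite integral_indic // setIT.
rewrite (iE m2) // (iE m1) //.
apply: (@le_trans _ _ (\int[m2]_x (tent a b n.+1%:R x)%:E)%E).
  apply: ge0_le_integral => //.
  - exact/measurable_EFinP.
  - exact/measurable_EFinP.
  move=> x _; rewrite lee_fin indicE.
  case: (boolP (x \in F n)) => [|_]; last exact: tent_ge0.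
  by rewrite inE => xF; rewrite tent_eq1.
apply: (le_trans (h n)); apply: ge0_le_integral => //.
- by move=> x _; rewrite lee_fin tent_ge0.
- exact/measurable_EFinP.
- exact/measurable_EFinP.
move=> x _; rewrite lee_fin indicE.
case: (boolP (x \in _)) => [_|]; first exact: tent_le1.
by rewrite notin_setE /= => xab; rewrite tent_off //; apply/negP.
Unshelve. all: by end_near. Qed.

End Tent.

(** * From open intervals to Borel sets *)

Lemma itv_bnd_bigcap (R : realType) (a : itv_bound R) (b : R) :
  \bigcap_n [set` Interval a (BLeft (b + n.+1%:R^-1))] =
  [set` Interval a (BRight b)].
Proof.
apply/seteqP; split=> x /=.
  move=> h; rewrite itv_boundlr; have := h 0%N Logic.I.
  rewrite /= itv_boundlr => /andP[-> _] /=.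
  rewrite bnd_simp; apply/ler_addgt0Pr => e e0.
  have := h (Num.bound e^-1) Logic.I; rewrite /= itv_boundlr => /andP[_].
  rewrite bnd_simp => /ltW /le_trans; apply; rewrite lerD2l.
  rewrite invf_ple ?posrE ?ltr0n // ltW // (lt_trans (archi_boundP _)) //.
    by rewrite invr_ge0 ltW.
  by rewrite ltr_nat.
rewrite itv_boundlr => /andP[ax xb] n _ /=; rewrite itv_boundlr ax /=.
move: xb; rewrite !bnd_simp => xb.
by rewrite (le_lt_trans xb) // ltrDl invr_gt0.
Qed.

Section FiniteMeasure.
Variables (R : realType) (m : {measure set (measurableTypeR R) -> \bar R}).
Hypothesis m_fin : (m setT < +oo)%E.

Let mi (i : interval R) : measurable ([set` i] : set (measurableTypeR R)).
Proof. exact: measurable_itv. Qed.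

Lemma measure_itv_fin_num (i : interval R) : m [set` i] \is a fin_num.
Proof.
by rewrite ge0_fin_numE // (le_lt_trans _ m_fin) // le_measure ?inE.
Qed.

Lemma cvg_measure_itv_right (a : itv_bound R) (b : R) :
  m [set` Interval a (BLeft (b + n.+1%:R^-1))] @[n --> \oo] -->
  m [set` Interval a (BRight b)].
Proof.
rewrite -itv_bnd_bigcap; apply: nonincreasing_cvg_mu => //.
- by rewrite -ge0_fin_numE // measure_itv_fin_num.
- by apply: bigcapT_measurable.
move=> n p np; apply/subsetPset => x; rewrite /= !itv_boundlr.
move=> /andP[-> /=]; rewrite !bnd_simp => /lt_le_trans; apply.
by rewrite lerD2l lef_pV2 ?posrE ?ltr0n // ler_nat.
Qed.

(** Real-valued, and for a finite measure rather than for the law of a random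
    variable. *)
Definition cdf_of (x : R) : R := fine (m `]-oo, x]%classic).

Lemma cdf_ofB (x y : R) :
  x <= y -> m `]x, y]%classic = (cdf_of y - cdf_of x)%:E.
Proof.
move=> xy; rewrite EFinB /cdf_of !fineK ?measure_itv_fin_num //.
have -> : `]-oo, y]%classic = `]-oo, x]%classic `|` `]x, y]%classic :> set R.
  by rewrite -itv_bndbnd_setU // bnd_simp.
rewrite measureU //; last first.
  apply/seteqP; split=> // z [] /=; rewrite !in_itv /= => zx /andP[xz _].
  by have := lt_le_trans xz zx; rewrite ltxx.
by rewrite addeAC subee ?add0e // measure_itv_fin_num.
Qed.

Lemma cdf_of_right_continuous : right_continuous cdf_of.
Proof.
have nd x y : x <= y -> cdf_of x <= cdf_of y.
  by move=> xy; rewrite -subr_ge0 -lee_fin -cdf_ofB.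
move=> x; apply/cvgrPdist_lt => e e0.
have := @cvg_measure_itv_right -oo%O x.
rewrite -[X in _ --> X]fineK ?measure_itv_fin_num //.
move=> /fine_cvgP[_ /cvgrPdist_lt/(_ e e0)[n _ /(_ n (leqnn n))]] /=.
rewrite -/(cdf_of x) ltr_norml => /andP[h _].
near=> y.
have xy : x <= y by near: y; apply: nbhs_right_ge.
have yn : y < x + n.+1%:R^-1.
  by near: y; apply: nbhs_right_lt; rewrite ltrDl invr_gt0.
have yle : cdf_of y <= fine (m `]-oo, (x + n.+1%:R^-1)[%classic).
  rewrite fine_le ?measure_itv_fin_num // le_measure ?inE //.
  by apply: subset_itvl; rewrite bnd_simp.
rewrite distrC ger0_norm ?subr_ge0 ?nd //; lra.
Unshelve. all: by end_near. Qed.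

End FiniteMeasure.

Section Comparison.
Variables (R : realType) (m1 m2 : {measure set (measurableTypeR R) -> \bar R}).
Hypothesis m1_fin : (m1 setT < +oo)%E.
Hypothesis m2_fin : (m2 setT < +oo)%E.
Hypothesis m12 : forall a b : R, (m2 `]a, b[%classic <= m1 `]a, b[%classic)%E.

Let F (x : R) : R := cdf_of m1 x - cdf_of m2 x.

Let F_nondecreasing : nondecreasing F.
Proof.
move=> x y xy; rewrite /F lerBrDr addrAC -lerBrDr -subr_ge0.
have : (m2 `]x, y]%classic <= m1 `]x, y]%classic)%E.
  apply: (lee_cvg_to (@cvg_measure_itv_right _ _ m2_fin (BRight x) y)
                     (@cvg_measure_itv_right _ _ m1_fin (BRight x) y)).
  by apply: nearW => n; exact: m12.
rewrite !cdf_ofB // lee_fin; lra.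
Qed.

Let F_right_continuous : right_continuous F.
Proof. by move=> x; apply: cvgB; exact: cdf_of_right_continuous. Qed.

HB.instance Definition _ :=
  isCumulative.Build R _ R F F_nondecreasing F_right_continuous.

(** [m2] plus the Stieltjes measure of [F] agrees with [m1] on the half-open
    intervals, which are stable under intersection and generate the Borel sets;
    so [m1] exceeds [m2] by a measure. *)
Lemma measure_le_of_itv_oo : measure_le m2 m1.
Proof.
pose m3 : {measure set (measurableTypeR R) -> \bar R} :=
  lebesgue_stieltjes_measure F.
have m3E a b : a <= b -> m3 `]a, b]%classic = (F b - F a)%:E.
  move=> ab; rewrite /m3 /= /lebesgue_stieltjes_measure /measure_extension /=.
  rewrite measurable_mu_extE /=; last exact: is_ocitv.
  by rewrite wlength_itv_bnd.
move=> A mA.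
suff -> : m1 A = measure_add m2 m3 A by rewrite measure_addE leeDl.
apply: (@measure_unique _ R (measurableTypeR R) (@ocitv R)
  (fun k => `](- k%:R), k%:R]%classic)) => //.
- exact: ocitvI.
- by move=> k; exact: is_ocitv.
- apply/seteqP; split=> // x _; exists (Num.bound `|x|) => //=.
  have := archi_boundP (normr_ge0 x).
  by rewrite ltr_norml in_itv /= => /andP[-> /ltW].
- move=> _ [[a b] _ <-]; rewrite -[RHS]/(measure_add m2 m3 _) measure_addE /=.
  have [ab|ba] := leP a b.
    by rewrite m3E // !cdf_ofB // -EFinD /F; congr _%:E; ring.
  have -> : `]a, b]%classic = set0 :> set (measurableTypeR R).
    by apply: set_itv_ge; rewrite bnd_simp -leNgt ltW.
  by rewrite !measure0 adde0.
- by move=> k; rewrite -ge0_fin_numE // measure_itv_fin_num.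
Qed.

End Comparison.

(** * The limits of the zero counting measures *)

Theorem theorem7p2 (R : realType)
    (mu1 mu2 : {finite_measure set (measurableTypeR R) -> \bar R})
    (alpha beta : R) (n : nat -> nat)
    (nu1 nu2 : {finite_measure set (measurableTypeR R) -> \bar R})
    (mu1_infinite : infinite_set (measure_support mu1))
    (mu2_infinite : infinite_set (measure_support mu2))
    (mu1_compact : compact (measure_support mu1))
    (mu2_compact : compact (measure_support mu2))
    (alpha_lt_beta : alpha < beta)
    (mu_le : measure_le mu1 mu2)
    (mu_eq : measure_eq (restr_oo mu1 alpha beta) (restr_oo mu2 alpha beta))
    (n_oo : n @ \oo --> \oo)
    (nu1_lim : weak_cvg (fun j => zero_counting_measure mu1 (n j)) nu1)
    (nu2_lim : weak_cvg (fun j => zero_counting_measure mu2 (n j)) nu2) :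
  measure_le (restr_oo nu2 alpha beta) (restr_oo nu1 alpha beta).
Proof.
have [M [mu1M mu2M]] : exists M : R,
    mu1 (~` `[- M, M]) = 0%E /\ mu2 (~` `[- M, M]) = 0%E.
  have b1 := compact_support_bounded mu1_compact.
  have b2 := compact_support_bounded mu2_compact.
  by have [M] := filter_ex (filterI b1 b2); exists M.
(* intersecting with [(alpha, beta)] turns any open interval into one on which
   the trapezoids vanish outside [(alpha, beta)] *)
have restr_itv (nu : {finite_measure set (measurableTypeR R) -> \bar R}) a b :
    restr_oo nu alpha beta `]a, b[%classic =
    nu `](Num.max a alpha), (Num.min b beta)[%classic.
  rewrite /= /mrestr; congr (nu _); apply/seteqP; split=> x.
    move=> [] /=; rewrite !in_itv /= gt_max lt_min.
    by move=> /andP[-> ->] /andP[-> ->].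
  by rewrite /= !in_itv /= gt_max lt_min => /andP[/andP[-> ->] /andP[-> ->]].
have restr_fin (nu : {finite_measure set (measurableTypeR R) -> \bar R}) :
    (restr_oo nu alpha beta setT < +oo)%E.
  rewrite /= /mrestr -ge0_fin_numE // fin_num_measure //.
  by apply: measurableI => //; exact: measurable_itv.
apply: measure_le_of_itv_oo => // a b; rewrite !restr_itv.
apply: measure_itv_oo_le_tent => k.
set a' := Num.max a alpha; set b' := Num.min b beta.
have k0 : (0 <= k.+1%:R :> R) by [].
apply: (le_integral_weak_limits mu1_infinite mu2_infinite mu_le mu_eq mu1M mu2M
  n_oo nu1_lim nu2_lim _ (tent_lipschitz a' b' k0)).
- exists 1; split=> // B B1 x _ /=.
  by rewrite ger0_norm ?tent_ge0 // (le_trans (tent_le1 _ _ _ _)) // ltW.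
- exact: tent_ge0.
move=> x xab; apply: tent_off => //; apply: contra xab.
rewrite !in_itv /= gt_max lt_min.
by move=> /andP[/andP[_ ->] /andP[_ ->]].
Qed.
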